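(* Let $n\ge 3$. Suppose that $\phi: M^n\to\mathbb{H}^{n+1}$ is a properly immersed, complete, horospherically convex hypersurface whose Gauss map $G:M^n\to\mathbb{S}^n$ is regular at infinity. Then $$\partial G(M^n)\subseteq\partial_\infty\phi(M^n),$$ where $\partial G(M^n)$ is the topological boundary of $G(M^n)$ in $\mathbb{S}^n$.
   Context: $\mathbb{R}^{1,n+1}$ is $\mathbb{R}^{n+2}$ with $\langle\bar x,\bar x\rangle=-x_0^2+\sum_{i=1}^{n+1}x_i^2$, and $\mathbb{H}^{n+1}=\{\bar x:\langle\bar x,\bar x\rangle=-1,\ x_0>0\}$. The ideal boundary of $\mathbb{H}^{n+1}$ is the unit sphere $\mathbb{S}^n$, where $x\in\mathbb{S}^n$ corresponds to the null ray through $(1,x)$. An immersed hypersurface $\phi:M^n\to\mathbb{H}^{n+1}$ is oriented by a unit normal field $\eta$, viewed as a map into $\{\bar x:\langle\bar x,\bar x\rangle=1\}$; its principal curvatures $\kappa_i$ are defined by $d\eta(e_i)=-\kappa_i\,d\phi(e_i)$ in an orthonormal basis of principal directions. ''Complete'' means that the induced metric on $M^n$ is complete. $\phi$ is horospherically convex if at each $p$ the hypersurface lies locally on one side of the horosphere $\mathcal{H}_p$ tangent to it at $\phi(p)$ with inward normal $\eta(p)$, touches it (near $p$) only at $p$, and the distance to $\mathcal{H}_p$ does not vanish to second order in any direction; equivalently, at each point all $\kappa_i<1$ or all $\kappa_i>1$. By convention the orientation is chosen so that all $\kappa_i<1$ everywhere. The Gauss map $G:M^n\to\mathbb{S}^n$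 sends $p$ to the point at infinity of $\mathcal{H}_p$; equivalently $\phi+\eta=e^{\tilde\rho}(1,G)$ for a function $\tilde\rho$ on $M^n$. The boundary at infinity $\partial_\infty\phi(M^n)\subset\mathbb{S}^n$ is the set of $x\in\mathbb{S}^n$ that are limits, in the Euclidean topology of the closed ball $\overline{\mathbb{B}^{n+1}}$, of sequences of points of the hypersurface in the Poincaré ball model $\mathbb{B}^{n+1}$. The Gauss map of a properly immersed hypersurface is regular at infinity if for each $p\in\partial_\infty\phi(M^n)$ and each sequence $q_i\in M^n$ with $\phi(q_i)\to p$ one has $\lim_{i\to\infty}G(q_i)=p$. *)

(* Defs.v *)
From HB Require Import structures.
From mathcomp Require Import all_boot all_order all_algebra.
From mathcomp Require Import all_classical all_reals all_analysis.
Set Implicit Arguments.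
Unset Strict Implicit.
Unset Printing Implicit Defensive.
Import Order.TTheory GRing.Theory Num.Theory.
Import numFieldNormedType.Exports.
Local Open Scope classical_set_scope.
Local Open Scope ring_scope.

(* Vectors of R^k are row vectors 'rV[R]_k; the norm of the library on this type
   is the sup norm, so it is only used for the topology and for derivatives,
   never for the geometry. *)

Section Minkowski.
Context {R : realType}.

Definition dot (k : nat) (u v : 'rV[R]_k) : R := \sum_(i < k) u 0 i * v 0 i.

Definition sphere (k : nat) : set 'rV[R]_k := [set x | dot x x = 1].

(* Frontier of A in the subspace topology of S, for A `<=` S. *)
Definition boundary_in (k : nat) (S A : set 'rV[R]_k) : set 'rV[R]_k :=
  S `&` (closure A `&` closure (S `\` A)).

Context {n : nat}.

(* R^{1,n+1}, split as the coordinate x_0 and the coordinates x_1 .. x_{n+1}. *)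
Notation mink_space := 'rV[R]_(1 + n.+1).

Definition time (x : mink_space) : R := lsubmx x 0 0.
Definition space (x : mink_space) : 'rV[R]_n.+1 := rsubmx x.

Definition mink (x y : mink_space) : R :=
  - (time x * time y) + dot (space x) (space y).

Definition hyperbolic : set mink_space :=
  [set x | mink x x = - 1 /\ 0 < time x].

(* arcosh c = ln (c + sqrt (c^2 - 1)) with c = - <x, y> *)
Definition hdist (x y : mink_space) : R :=
  let c := - mink x y in ln (c + Num.sqrt (c ^+ 2 - 1)).

Definition hdist_set (A : set mink_space) (x : mink_space) : R :=
  inf [set hdist x y | y in A].

(* Stereographic projection from (-1, 0) onto the open unit ball. *)
Definition poincare (x : mink_space) : 'rV[R]_n.+1 := (1 + time x)^-1 *: space x.

Definition null_vector (x : 'rV[R]_n.+1) : mink_space := row_mx (const_mx 1) x.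

(* The horospheres with point at infinity x are the level sets in hyperbolic
   space of <., (1, x)>; horosphere x s bounds the horoball
   { y | <y, (1, x)> >= - e^{-s} }. *)
Definition horosphere (x : 'rV[R]_n.+1) (s : R) : set mink_space :=
  hyperbolic `&` [set y | mink y (null_vector x) = - expR (- s)].

(* The unit normal of horosphere x s at y that points into the horoball: the
   component of e^s (1, x) tangent to hyperbolic space at y. *)
Definition horo_normal (x : 'rV[R]_n.+1) (s : R) (y : mink_space) : mink_space :=
  expR s *: null_vector x - y.

End Minkowski.

Section Manifold.
Context {R : realType}.

Fixpoint Ck (k j m : nat) (U : set 'rV[R]_j) (f : 'rV[R]_j -> 'rV[R]_m) : Prop :=
  match k with
  | 0%N => forall x, U x -> {for x, continuous f}
  | k'.+1 => (forall x, U x -> differentiable f x) /\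
             (forall v, Ck k' U ('D_v f))
  end.

(* Only meant for open U. *)
Definition smooth_on (j m : nat) (U : set 'rV[R]_j) (f : 'rV[R]_j -> 'rV[R]_m) :=
  forall k, Ck k U f.

Context {n : nat} {M : topologicalType}.

(* coord and param are total functions, only meaningful on dom and on
   coord @` dom respectively. *)
Record chart := Chart {
  dom : set M;
  coord : M -> 'rV[R]_n;
  param : 'rV[R]_n -> M }.

Definition range_of (c : chart) : set 'rV[R]_n := coord c @` dom c.

Definition is_chart (c : chart) : Prop :=
  [/\ open (dom c), open (range_of c),
      forall p, dom c p -> param c (coord c p) = p,
      forall p, dom c p -> {for p, continuous (coord c)} &
      forall x, range_of c x -> {for x, continuous (param c)}].

Definition smooth_atlas (A : set chart) : Prop :=
  [/\ forall c, A c -> is_chart c,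
      forall p, exists2 c, A c & dom c p &
      forall c d, A c -> A d ->
        smooth_on (coord c @` (dom c `&` dom d)) (coord d \o param c)].

Definition smooth_manifold (A : set chart) : Prop :=
  [/\ hausdorff_space M, second_countable (T := M) & smooth_atlas A].

Definition smooth_map (A : set chart) (m : nat) (f : M -> 'rV[R]_m) : Prop :=
  forall c, A c -> smooth_on (range_of c) (f \o param c).

(* The differential of f at p, applied to the tangent vector with components w
   in the chart c. *)
Definition dmap (c : chart) (m : nat) (f : M -> 'rV[R]_m) (p : M)
    (w : 'rV[R]_n) : 'rV[R]_m :=
  'D_w (f \o param c) (coord c p).

(* gamma is C^1 on the closed interval [0, 1]; being differentiable near the end
   points costs no generality, since C^1 arcs extend past their end points. *)
Definition C1_arc (A : set chart) (gamma : R -> M) : Prop :=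
  forall t, 0 <= t <= 1 -> {for t, continuous gamma} /\
    forall c, A c -> dom c (gamma t) ->
      (\forall s \near t, derivable (coord c \o gamma) s 1) /\
      {for t, continuous (derive1 (coord c \o gamma))}.

End Manifold.

Arguments chart : clear implicits.

Section Hypersurface.
Context {R : realType} {n : nat} {M : topologicalType}.
Implicit Types (A : set (chart R n M)) (phi eta : M -> 'rV[R]_(1 + n.+1))
  (G : M -> 'rV[R]_n.+1).

(* Immersions into hyperbolic space oriented by the unit normal field eta. *)
Record immersed_hypersurface A phi eta : Prop := ImmersedHypersurface {
  phi_hyperbolic : forall p, hyperbolic (phi p);
  phi_smooth : smooth_map A phi;
  phi_immersion : forall c p w, A c -> dom c p -> w != 0 -> dmap c phi p w != 0;
  eta_smooth : smooth_map A eta;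
  eta_unit : forall p, mink (eta p) (eta p) = 1;
  eta_tangent : forall p, mink (eta p) (phi p) = 0;
  eta_normal : forall c p w, A c -> dom c p -> mink (eta p) (dmap c phi p w) = 0 }.

Definition properly_immersed phi : Prop :=
  forall K, compact K -> K `<=` hyperbolic -> compact (phi @^-1` K).

(* Length for the induced metric: the squared norm of gamma'(t) is
   <(phi o gamma)'(t), (phi o gamma)'(t)>. *)
Definition arc_length phi (gamma : R -> M) : R :=
  let v := derive1 (phi \o gamma) in
  \int[lebesgue_measure]_(t in `[0, 1]) Num.sqrt (mink (v t) (v t)).

(* There is a piecewise C^1 curve of length l from p to q. *)
Inductive curve_of_length A phi : M -> M -> R -> Prop :=
| curve_const p : curve_of_length A phi p p 0
| curve_arc gamma q l : C1_arc A gamma -> curve_of_length A phi (gamma 1) q l ->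
    curve_of_length A phi (gamma 0) q (arc_length phi gamma + l).

Definition induced_dist A phi (p q : M) : \bar R :=
  ereal_inf [set l%:E | l in [set l | curve_of_length A phi p q l]].

Definition complete_hypersurface A phi : Prop :=
  forall u : nat -> M,
    (forall e : R, 0 < e -> exists N, forall i j, (N <= i)%N -> (N <= j)%N ->
       (induced_dist A phi (u i) (u j) < e%:E)%E) ->
    exists p, forall e : R, 0 < e -> exists N, forall i, (N <= i)%N ->
       (induced_dist A phi (u i) p < e%:E)%E.

(* The eigenvalues of the shape operator, d eta (e) = - kappa d phi (e) for a
   unit principal direction e. *)
Definition principal_curvature A phi eta (p : M) (kappa : R) : Prop :=
  exists c e, [/\ A c, dom c p, mink (dmap c phi p e) (dmap c phi p e) = 1 &
    dmap c eta p e = - kappa *: dmap c phi p e].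

(* horosphere x s is tangent to the hypersurface at phi p with inward normal
   eta p. *)
Definition tangent_horosphere phi eta (p : M) (x : 'rV[R]_n.+1) (s : R) : Prop :=
  [/\ sphere x, horosphere x s (phi p) & horo_normal x s (phi p) = eta p].

(* By definition of horo_normal, phi + eta = e^s (1, G) for some s. *)
Definition gauss_map phi eta G : Prop :=
  forall p, exists s, tangent_horosphere phi eta p (G p) s.

Definition locally_one_side phi (p : M) (x : 'rV[R]_n.+1) (s : R) : Prop :=
  (\forall q \near p, - expR (- s) <= mink (phi q) (null_vector x)) \/
  (\forall q \near p, mink (phi q) (null_vector x) <= - expR (- s)).

Definition touches_only_at phi (p : M) (x : 'rV[R]_n.+1) (s : R) : Prop :=
  \forall q \near p, horosphere x s (phi q) -> q = p.

(* In no direction w is the distance to the horosphere o(t^2) along the chart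
   line t |-> coord p + t w.  The distance vanishes to first order at p, so the
   choice of a curve with a given velocity is immaterial. *)
Definition nonvanishing_second_order A phi (p : M) (x : 'rV[R]_n.+1) (s : R) :=
  forall c w, A c -> dom c p -> w != 0 ->
    ~ (hdist_set (horosphere x s) (phi (param c (coord c p + t *: w))) / t ^+ 2
         @[t --> 0^'] --> (0 : R)).

Definition horospherically_convex A phi eta : Prop :=
  forall p, exists x s,
    [/\ tangent_horosphere phi eta p x s, locally_one_side phi p x s,
        touches_only_at phi p x s & nonvanishing_second_order A phi p x s].

(* The convention that fixes the orientation of a horospherically convex
   hypersurface. *)
Definition curvatures_lt1 A phi eta : Prop :=
  forall p kappa, principal_curvature A phi eta p kappa -> kappa < 1.

Definition ideal_boundary phi : set 'rV[R]_n.+1 :=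
  [set x | sphere x /\
     exists u : nat -> M, poincare (phi (u i)) @[i --> \oo] --> x].

Definition regular_at_infinity phi G : Prop :=
  forall x, ideal_boundary phi x -> forall u : nat -> M,
    poincare (phi (u i)) @[i --> \oo] --> x -> G (u i) @[i --> \oo] --> x.

End Hypersurface.

(* Main.v *)
Require Import Defs.
From HB Require Import structures.
From mathcomp Require Import all_boot all_order all_algebra.
From mathcomp Require Import all_classical all_reals all_analysis.
From mathcomp Require Import ring lra.
Set Implicit Arguments.
Unset Strict Implicit.
Unset Printing Implicit Defensive.
Import Order.TTheory GRing.Theory Num.Theory.
Import numFieldNormedType.Exports.
Local Open Scope classical_set_scope.
Local Open Scope ring_scope.

(* Let x be in the boundary of G(M), say x = lim G(q_i).  If phi(q_i) leaves
   every compact set, a subsequence converges to a point of the ideal boundary,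
   and regularity at infinity identifies this point with x.  Otherwise properness
   gives x = G(q) for some q, which is impossible because G(M) is a neighbourhood
   of G(q) in the sphere.  The latter is seen without the inverse function
   theorem: by horospherical convexity p |-> <phi(p), (1, G(q))> has a strict
   local extremum at q, so for z near G(q) the function <phi, (1, z)> still has a
   local extremum at some p near q.  There (1, z) is normal to the hypersurface,
   hence a null combination of phi(p) and eta(p), i.e. proportional to
   phi(p) + eta(p) or phi(p) - eta(p); nearness to q excludes the second
   possibility, so z = G(p). *)

(** * Linear algebra of the Minkowski form *)

Section MinkowskiForm.
Context {R : realType} {n : nat}.
Implicit Types x y z p e u : 'rV[R]_(1 + n.+1).

(** With the form written as a matrix product, orthogonality to the rows of a matrix becomes
    membership in a kernel, so that ranks can be counted. *)
Definition mink_gram : 'M[R]_(1 + n.+1) := block_mx (- 1%:M) 0 0 1%:M.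

Lemma minkE x y : mink x y = (x *m mink_gram *m y^T) 0 0.
Proof.
rewrite /mink /time /Defs.space /mink_gram /dot.
rewrite -{3}(hsubmxK x) -{3}(hsubmxK y) mul_row_block tr_row_mx mul_row_col.
rewrite !mulmx0 addr0 add0r mulmxN !mulmx1 !mxE big_ord1 !mxE mulNr.
by congr (_ + _); apply: eq_bigr => i _; rewrite !mxE.
Qed.

Lemma dotC k (u v : 'rV[R]_k) : dot u v = dot v u.
Proof. by apply: eq_bigr => i _; rewrite mulrC. Qed.

Lemma minkC x y : mink x y = mink y x.
Proof. by rewrite /mink dotC mulrC. Qed.

Lemma minkDl x y z : mink (x + y) z = mink x z + mink y z.
Proof. by rewrite !minkE !mulmxDl !mxE. Qed.

Lemma minkZl a x y : mink (a *: x) y = a * mink x y.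
Proof. by rewrite !minkE -!scalemxAl !mxE. Qed.

Lemma minkDr x y z : mink z (x + y) = mink z x + mink z y.
Proof. by rewrite minkC minkDl !(minkC z). Qed.

Lemma minkZr a x y : mink y (a *: x) = a * mink y x.
Proof. by rewrite minkC minkZl minkC. Qed.

Lemma minkNr x y : mink y (- x) = - mink y x.
Proof. by rewrite -scaleN1r minkZr mulN1r. Qed.

Lemma mink_null_vector (x : 'rV[R]_n.+1) : sphere x ->
  mink (null_vector x) (null_vector x) = 0.
Proof.
rewrite /sphere /mink /time /Defs.space /null_vector row_mxKl row_mxKr !mxE mulr1.
by move=> ->; rewrite addNr.
Qed.

Lemma mink_gram_perp m (J : 'M[R]_(m, 1 + n.+1)) u :
  (forall w : 'rV_m, mink (w *m J) u = 0) -> u *m (mink_gram *m J^T) = 0.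
Proof.
move=> Ju; apply/rowP => j.
have := Ju (delta_mx 0 j); rewrite minkC minkE -rowE => Ej.
rewrite mulmxA [RHS]mxE -[RHS]Ej [LHS]mxE [RHS]mxE.
by apply: eq_bigr => i _; rewrite !mxE.
Qed.

(** The form is nondegenerate, so the orthogonal complement of the [n]-dimensional row space of [J]
    has dimension 2; [p] and [e] lie in it and are independent. *)
Lemma mem_span_mink_perp (J : 'M[R]_(n, 1 + n.+1)) p e u :
  row_free J -> mink p p = -1 -> mink e e = 1 -> mink e p = 0 ->
  (forall w : 'rV_n, mink (w *m J) p = 0) ->
  (forall w : 'rV_n, mink (w *m J) e = 0) ->
  (forall w : 'rV_n, mink (w *m J) u = 0) ->
  exists a b, u = a *: p + b *: e.
Proof.
move=> Jfree pp ee ep /mink_gram_perp Jp /mink_gram_perp Je /mink_gram_perp Ju.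
(* The row space of [K] is the orthogonal complement of the rows of [J]. *)
set K := kermx (mink_gram *m J^T).
have gramK : mink_gram *m mink_gram = 1%:M.
  rewrite /mink_gram mulmx_block !mulmx0 !mul0mx !addr0 add0r mulmxN mulNmx.
  by rewrite opprK !mulmx1 -scalar_mx_block.
have gram_unit : mink_gram \in unitmx by have [] := mulmx1_unit gramK.
have rankK : \rank K = 2%N.
  rewrite mxrank_ker -mxrank_tr trmx_mul trmxK mxrankMfree.
    by rewrite (eqP Jfree) add1n -addn2 addKn.
  by rewrite row_free_unit unitmx_tr.
have rank_pe : \rank (col_mx p e) = 2%N.
  apply/eqP; change (row_free (col_mx p e)); rewrite -kermx_eq0.
  apply/eqP/row_matrixP => i; rewrite row0.
  set c := row i _.
  have : c *m col_mx p e = 0 by rewrite -row_mul mulmx_ker row0.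
  rewrite -(hsubmxK c) mul_row_col (mx11_scalar (lsubmx c)).
  rewrite (mx11_scalar (rsubmx c)) !mul_scalar_mx => c0.
  have mink0 y : mink 0 y = 0 by rewrite -(scale0r y) minkZl mul0r.
  (* Pairing the relation [c0] with [p], then with [e], kills its two coefficients. *)
  have := congr1 (mink^~ p) c0; rewrite /= minkDl !minkZl ep pp mink0.
  rewrite mulr0 addr0 mulrN1 => /eqP; rewrite oppr_eq0 => /eqP ->.
  have := congr1 (mink^~ e) c0; rewrite /= minkDl !minkZl ee (minkC p) ep mink0.
  rewrite mulr0 add0r mulr1 => ->.
  by rewrite raddf0 row_mx0.
(* Equality of ranks turns the inclusion of the span of [p] and [e] in [K] into the reverse one. *)
have : (K <= col_mx p e)%MS.
  rewrite -(mxrank_leqif_sup _) ?rank_pe ?rankK //.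
  by apply/sub_kermxP; rewrite mul_col_mx Jp Je col_mx0.
move=> Kpe; have /submxP[c ->] : (u <= col_mx p e)%MS.
  by apply: submx_trans Kpe; apply/sub_kermxP.
exists (lsubmx c 0 0), (rsubmx c 0 0).
by rewrite -{1}(hsubmxK c) mul_row_col {1}(mx11_scalar (lsubmx c))
  {1}(mx11_scalar (rsubmx c)) !mul_scalar_mx.
Qed.

End MinkowskiForm.

(** * Limits and derivatives of the Minkowski product *)

Section MinkowskiCalculus.
Context {R : realType} {n : nat}.
Notation mink_space := 'rV[R]_(1 + n.+1).

Lemma mink_coord (x y : mink_space) : mink x y =
  - (x 0 (lshift _ 0) * y 0 (lshift _ 0)) +
    \sum_(i < n.+1) x 0 (rshift 1 i) * y 0 (rshift 1 i).
Proof.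
rewrite /mink /time /Defs.space /dot !mxE.
by congr (_ + _); apply: eq_bigr => i _; rewrite !mxE.
Qed.

Lemma cvg_mx_coord {T : Type} {F : set_system T} {FF : Filter F} (k m : nat)
    (f : T -> 'M[R]_(k, m)) (a : 'M[R]_(k, m)) i j :
  f x @[x --> F] --> a -> f x i j @[x --> F] --> a i j.
Proof.
move=> fa; pose c (N : 'M[R]_(k, m)) : R := N i j.
exact: (@cvg_comp _ _ _ f c _ _ _ fa (@coord_continuous R k m i j a)).
Qed.

Lemma cvg_mink {T : Type} {F : set_system T} {FF : Filter F}
    (f g : T -> mink_space) (a b : mink_space) :
  f x @[x --> F] --> a -> g x @[x --> F] --> b ->
  mink (f x) (g x) @[x --> F] --> mink a b.
Proof.
move=> fa gb; under eq_fun do rewrite mink_coord; rewrite mink_coord.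
apply: cvgD; first by apply: cvgN; apply: cvgM; apply: cvg_mx_coord.
apply: cvg_big => [|i _]; [exact: add_continuous|apply: cvgM];
  exact: cvg_mx_coord.
Qed.

Lemma cvg_dot {T : Type} {F : set_system T} {FF : Filter F} k
    (f g : T -> 'rV[R]_k) (a b : 'rV[R]_k) :
  f x @[x --> F] --> a -> g x @[x --> F] --> b ->
  dot (f x) (g x) @[x --> F] --> dot a b.
Proof.
move=> fa gb; apply: cvg_big => [|i _]; [exact: add_continuous|apply: cvgM];
  exact: cvg_mx_coord.
Qed.

Lemma continuous_null_vector : continuous (@null_vector R n).
Proof.
move=> u A /nbhs_ballP[e /= e0 eA].
apply/nbhs_ballP; exists e => //= v [_ uv]; apply: eA; split => // i j.
rewrite /null_vector !mxE; case: (fintype.split j) => m; rewrite ?mxE.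
  exact: ballxx.
exact: uv.
Qed.

Lemma is_derive_mink k (f g : 'rV[R]_k -> mink_space) w v :
  differentiable f w -> differentiable g w ->
  is_derive w v (fun y => mink (f y) (g y))
    (mink ('D_v f w) (g w) + mink (f w) ('D_v g w)).
Proof.
move=> df dg.
have dcoord (h : 'rV[R]_k -> mink_space) i : differentiable h w ->
    is_derive w v (fun y => h y 0 i) ('D_v h w 0 i).
  move=> dh; rewrite derive_mx ?mxE; last exact: diff_derivable.
  apply/derivableP/diff_derivable.
  apply: (@differentiable_comp _ _ _ _ h
    (fun N : 'rV[R]_(1 + n.+1) => N 0 i) w dh).
  exact: differentiable_coord.
have dprod i : is_derive w v (fun y => f y 0 i * g y 0 i)
    (f w 0 i * 'D_v g w 0 i + 'D_v f w 0 i * g w 0 i).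
  rewrite [X in is_derive _ _ _ (_ + X)]mulrC.
  exact: (is_deriveM (dcoord f i df) (dcoord g i dg)).
rewrite [X in is_derive _ _ X _](_ : _ =
   - (fun y => f y 0 (lshift _ 0) * g y 0 (lshift _ 0)) +
   \sum_(i < n.+1) (fun y => f y 0 (rshift 1 i) * g y 0 (rshift 1 i))); last first.
  by apply/funext => y; rewrite mink_coord /= !fctE fct_sumE.
apply: is_derive_eq.
by rewrite [RHS]addrC !mink_coord big_split /= opprD addrACA.
Qed.

(** Restriction to the line [l] through [w] in direction [v] reduces this to the one-variable case
    at an interior minimum. *)
Lemma local_min_derive0 k (f : 'rV[R]_k -> R) w v :
  (\forall y \near w, derivable f y v) ->
  (\forall y \near w, f w <= f y) -> 'D_v f w = 0.
Proof.
move=> df fmin.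
pose l (t : R) := t *: v + w.
have l0 : l 0 = w by rewrite /l scale0r add0r.
have dl t : differentiable l t by [].
have /nbhs_ballP[e /= e0 he] :
    \forall t \near (0 : R), derivable f (l t) v /\ f w <= f (l t).
  have : \forall y \near l 0, derivable f y v /\ f w <= f y.
    by rewrite l0; exact: filterI df fmin.
  by move/(differentiable_continuous (dl 0)).
have in_ball t : t \in `]- e, e[ -> derivable f (l t) v /\ f w <= f (l t).
  rewrite in_itv /= => te; apply: he.
  by rewrite /ball /= sub0r normrN ltr_norml.
have /(@derive_val _ _ _ _ _ _ _) <- : is_derive (0 : R) 1 (f \o l) 0.
  apply: (@derive1_at_min R (f \o l) (- e) e).
  - by rewrite ge0_cp // ltW.
  - move=> t /in_ball[dft _]; move: dft.
    rewrite /derivable.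
    (* The difference quotient of [f \o l] at [t] is that of [f] at [l t] in direction [v]. *)
    set g1 := fun h => h^-1 *: _; set g2 := fun h => h^-1 *: _.
    suff -> : g1 = g2 by [].
    by rewrite funeqE /g1 /g2 => h /=; rewrite /l [_%:A]mulr1 scalerDl addrA.
  - by rewrite in_itv /= oppr_lt0 e0.
  - by move=> t /in_ball[_]; rewrite /= l0.
rewrite /derive; set g1 := fun h => h^-1 *: _; set g2 := fun h => h^-1 *: _.
suff -> : g1 = g2 by [].
by rewrite funeqE /g1 /g2 => h /=; rewrite addr0 /l scale0r add0r [_%:A]mulr1.
Qed.
End MinkowskiCalculus.

(** * Persistence of local minima under perturbation *)

Lemma cvg_slicel (Z W U : topologicalType) (g : Z -> W -> U) z w :
  g p.1 p.2 @[p --> (z, w)] --> g z w -> g z' w @[z' --> z] --> g z w.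
Proof.
move=> gc.
exact: (@cvg_comp2 _ _ _ _ (nbhs z) _ _ _ _ _ _
  id (cst w) g cvg_id (cvg_cst w) gc).
Qed.

Lemma cvg_slicer (Z W U : topologicalType) (g : Z -> W -> U) z w :
  g p.1 p.2 @[p --> (z, w)] --> g z w -> g z w' @[w' --> w] --> g z w.
Proof.
move=> gc.
exact: (@cvg_comp2 _ _ _ _ (nbhs w) _ _ _ _ _ _
  (cst z) id g (cvg_cst z) cvg_id gc).
Qed.

Lemma continuous_dist (R : numFieldType) (V : normedModType R) (a : V) :
  continuous (fun x : V => `|a - x|).
Proof.
by move=> x; apply: cvg_norm; apply: cvgB; [exact: cvg_cst|exact: cvg_id].
Qed.

(** On a small sphere around [w0] the values of [g z0] exceed [g z0 w0], and by compactness this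
    survives for [z] near [z0]. A minimum of [g z] over the closed ball is then attained in the
    interior, hence is local. *)
Lemma near_exists_local_min (R : realType) (Z : topologicalType) (k : nat)
    (g : Z -> 'rV[R]_k -> R) z0 w0 (V : set 'rV[R]_k) :
  nbhs w0 V ->
  (\forall w \near w0, forall z, g p.1 p.2 @[p --> (z, w)] --> g z w) ->
  (\forall w \near w0, w <> w0 -> g z0 w0 < g z0 w) ->
  \forall z \near z0, exists2 w, V w & \forall w' \near w, g z w <= g z w'.
Proof.
move=> w0V gcont gstrict.
have : \forall w \near w0, [/\ V w, forall z, g p.1 p.2 @[p --> (z, w)] --> g z w
    & w <> w0 -> g z0 w0 < g z0 w].
  by near=> w; split; near: w.
move=> /nbhs_ballP[e /= e0 he].
pose r := e / 2.
have r0 : 0 < r by rewrite divr_gt0.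
have re : r < e by rewrite ltr_pdivrMr // ltr_pMr // ltr1n.
have {}he w : `|w0 - w| <= r -> [/\ V w,
    forall z, g p.1 p.2 @[p --> (z, w)] --> g z w & w <> w0 -> g z0 w0 < g z0 w].
  by move=> wr; apply: he; rewrite -ball_normE /=; exact: le_lt_trans re.
have cont_dist := @continuous_dist R 'rV[R]_k w0.
(* This covers both the sphere and the closed ball, as preimages of closed sets of distances. *)
have compact_le (B : set R) : closed B -> (forall s, B s -> s <= r) ->
    compact [set w : 'rV[R]_k | B `|w0 - w|].
  move=> Bcl Br; apply: bounded_closed_compact; last first.
    by apply: preimage_closed Bcl => w _; exact: cont_dist.
  exists (`|w0| + r); split; first exact: num_real.
  move=> M ltM w /Br wr.
  apply: le_trans (ltW ltM); rewrite -[in leLHS](subKr w0 w).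
  by apply: le_trans (ler_normB _ _) _; rewrite lerD2l.
have csphere : compact [set w : 'rV[R]_k | `|w0 - w| = r].
  by apply: (compact_le [set r]) => [|s ->//]; exact: closed_eq.
have cball : compact [set w : 'rV[R]_k | `|w0 - w| <= r].
  by apply: (compact_le [set s | s <= r]) => //; exact: closed_le.
have g_near w : `|w0 - w| = r ->
    \forall w' \near w & z \near z0, g z w0 < g z w'.
  move=> wr; have [_ gcw gw] := he w ltac:(by rewrite wr).
  have ww0 : w <> w0.
    by move=> ww0; move: wr r0; rewrite ww0 subrr normr0 => <-; rewrite ltxx.
  (* The midpoint of [g z0 w0] and [g z0 w] keeps the two values apart: nearby, [g z w0] stays below
     it and [g z w'] above it. *)
  have [mlt mgt] := midf_lt (gw ww0).
  have [_ gc0 _] := he w0 ltac:(by rewrite subrr normr0 ltW).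
  have gz0 : g z w0 @[z --> z0] --> g z0 w0.
    exact: cvg_slicel.
  have [[A B] /= [z0A wB] AB] := cvgr_gt _ (gcw z0) _ mgt.
  exists (B, A `&` [set z | g z w0 < (g z0 w0 + g z0 w) / 2]) => /=.
    by split => //; apply: filterI => //; exact: cvgr_lt mlt.
  by move=> [w' z] /= [Bw' [Az]] /lt_trans; apply; exact: (AB (z, w')).
have : \forall z \near z0, forall w, `|w0 - w| = r -> g z w0 < g z w.
  by move/compact_near_coveringP : csphere; apply.
apply: filterS => z gz.
have [] := @EVT_min_rV R k (g z) [set w | `|w0 - w| <= r] _ cball.
- by exists w0; rewrite /= subrr normr0 ltW.
- apply: continuous_in_subspaceT => w; rewrite inE => /he[_ gc _].
  exact: cvg_slicer.
move=> w; rewrite inE => wr wmin; exists w; first by have [] := he _ wr.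
(* The minimiser is not on the sphere, where the values exceed the value at the centre. *)
have wr' : `|w0 - w| < r.
  rewrite lt_neqAle wr andbT; apply/eqP => /gz.
  by rewrite ltNge wmin // inE /= subrr normr0 ltW.
have : \forall w' \near w, `|w0 - w'| < r.
  exact: (cont_dist w _ (lt_nbhsl wr')).
by apply: filterS => w' /ltW w'r; apply: wmin; rewrite inE.
Unshelve. all: by end_near.
Qed.

(** * Null normal vectors and the Gauss map *)

Section GaussMap.
Context {R : realType} {n : nat} {M : topologicalType}.
Context (A : set (chart R n M)) (phi eta : M -> 'rV[R]_(1 + n.+1)).
Context (hA : smooth_atlas A) (himm : immersed_hypersurface A phi eta).

Lemma scale_null_vector_inj (a b : R) (x y : 'rV[R]_n.+1) : b != 0 ->
  a *: null_vector x = b *: null_vector y -> a = b /\ x = y.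
Proof.
rewrite /null_vector !scale_row_mx => b0 /eq_row_mx[/matrixP/(_ 0 0)].
rewrite !mxE !mulr1 => -> /(scalerI b0).
by [].
Qed.

Lemma mink_hyperbolic p : mink (phi p) (phi p) = - 1.
Proof. by have [] := phi_hyperbolic himm p. Qed.

Lemma differentiable_in_chart (f : M -> 'rV[R]_(1 + n.+1)) c p :
  smooth_map A f -> A c -> dom c p ->
  differentiable (f \o param c) (Defs.coord c p).
Proof. by move=> + Ac cp => /(_ c Ac 1%N)[+ _]; apply; exists p. Qed.

(** Obtained by differentiating the constant function [mink (phi p) (phi p)]. *)
Lemma mink_differential c p w : A c -> dom c p ->
  mink (dmap c phi p w) (phi p) = 0.
Proof.
move=> Ac cp; have [chA _ _] := hA; have [_ _ paramK _ _] := chA _ Ac.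
have dphi : differentiable (phi \o param c) (Defs.coord c p).
  exact: differentiable_in_chart (phi_smooth himm) Ac cp.
have /(@derive_val _ _ _ _ _ _ _) := is_derive_mink w dphi dphi.
rewrite (_ : (fun y => _) = cst (-1)); last first.
  by apply/funext => y; exact: mink_hyperbolic.
rewrite derive_cst /= paramK // (minkC (phi p)) -mulr2n => /esym/eqP.
by rewrite mulrn_eq0 => /eqP.
Qed.

(** The rows of the Jacobian span the tangent space and are independent because [phi] is an
    immersion; [phi p] and [eta p] then span its orthogonal complement. *)
Lemma normal_plane c p u : A c -> dom c p ->
  (forall w, mink (dmap c phi p w) u = 0) ->
  exists a b, u = a *: phi p + b *: eta p.
Proof.
move=> Ac cp pu.
have dphi : differentiable (phi \o param c) (Defs.coord c p).
  exact: differentiable_in_chart (phi_smooth himm) Ac cp.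
have dmapE w : w *m jacobian (phi \o param c) (Defs.coord c p) = dmap c phi p w.
  by rewrite -deriveEjacobian.
apply: (@mem_span_mink_perp _ _ (jacobian (phi \o param c) (Defs.coord c p))).
- rewrite -kermx_eq0; apply/eqP/row_matrixP => i; rewrite row0.
  apply/eqP; apply: contraT => /(phi_immersion himm Ac cp).
  by rewrite -dmapE -row_mul mulmx_ker row0 eqxx.
- exact: mink_hyperbolic.
- exact: (eta_unit himm).
- exact: (eta_tangent himm).
- by move=> w; rewrite dmapE mink_differential.
- by move=> w; rewrite dmapE minkC (eta_normal himm).
- by move=> w; rewrite dmapE.
Qed.

Context (G : M -> 'rV[R]_n.+1).
Context (hG : gauss_map phi eta G).

Lemma gauss_mapE p : exists s, phi p + eta p = expR s *: null_vector (G p).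
Proof.
by have [s [_ _ <-]] := hG p; exists s; rewrite /horo_normal addrC subrK.
Qed.

(** The null vectors of [x] and of [G p] are both proportional to [phi p + eta p]. *)
Lemma tangent_horosphere_gauss p x s :
  tangent_horosphere phi eta p x s -> x = G p.
Proof.
have [t ht] := gauss_mapE p => -[_ _ hs].
have : expR s *: null_vector x = expR t *: null_vector (G p).
  by rewrite -ht -hs /horo_normal addrC subrK.
by move=> /(scale_null_vector_inj (lt0r_neq0 (expR_gt0 t)))[].
Qed.

(** Write the null vector as [a *: phi p + b *: eta p]. Nullity means that [a] and [b] have equal
    squares, and its product with [phi p - eta p] is [- (a + b)]; if this is nonzero then [a = b],
    and the vector lies on the line of [phi p + eta p]. *)
Lemma null_normal_gauss c p z : A c -> dom c p -> sphere z ->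
  (forall w, mink (dmap c phi p w) (null_vector z) = 0) ->
  mink (null_vector z) (phi p - eta p) != 0 -> z = G p.
Proof.
move=> Ac cp /mink_null_vector z0 /(normal_plane Ac cp)[a [b zab]] ab0.
have pe : mink (phi p) (eta p) = 0 by rewrite minkC (eta_tangent himm).
move: z0 ab0; rewrite zab !(minkDl, minkDr, minkZl, minkZr, minkNr).
rewrite (eta_tangent himm) pe (eta_unit himm) mink_hyperbolic.
rewrite !(mulr0, addr0, add0r, mulr1, mulrN1, subr0, oppr0) => eqab nab.
have ab : a = b.
  apply/eqP; rewrite -subr_eq0; apply: contraNT nab => amb.
  rewrite -opprD oppr_eq0 -(mulrI_eq0 _ (lregP amb)) -subr_sqr.
  by rewrite -oppr_eq0 opprB !expr2 addrC -mulrN eqab.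
have [s hs] := gauss_mapE p.
have a0 : a != 0 by apply: contraNneq nab => a0; rewrite -ab a0 oppr0 addr0.
have : 1 *: null_vector z = (a * expR s) *: null_vector (G p).
  by rewrite scale1r zab -ab -scalerDr hs scalerA.
by move=> /scale_null_vector_inj[]//; rewrite mulf_neq0 // gt_eqF ?expR_gt0.
Qed.

End GaussMap.

(** * Openness of the Gauss map *)

Section GaussMapOpen.
Context {R : realType} {n : nat} {M : topologicalType}.
Context (A : set (chart R n M)) (phi eta : M -> 'rV[R]_(1 + n.+1)).
Context (hA : smooth_atlas A) (himm : immersed_hypersurface A phi eta).
Context (G : M -> 'rV[R]_n.+1).
Context (hconvex : horospherically_convex A phi eta)
  (hG : gauss_map phi eta G).

(** The tangent horosphere is the level set of this function through [phi q]: lying on one side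
    gives an extremum, touching only at [q] makes it strict. The sign [sigma] records the side, so
    that only minima need be treated. *)
Lemma support_function_strict_extremum q : exists2 sigma : R, sigma != 0 &
  \forall p \near q, p <> q ->
    sigma * mink (phi q) (null_vector (G q)) <
    sigma * mink (phi p) (null_vector (G q)).
Proof.
have [x [s [hxs hside htouch _]]] := hconvex q.
have xG := tangent_horosphere_gauss hG hxs.
have [_ [_ /= hq] _] := hxs; rewrite -xG hq.
have {}htouch : \forall p \near q, p <> q ->
    - expR (- s) != mink (phi p) (null_vector x).
  apply: filterS htouch => p hp pq; apply/eqP => /esym hs.
  by apply: pq; apply: hp; split; [exact: phi_hyperbolic himm p|].
case: hside => hside; [exists 1|exists (-1)];
  rewrite ?oner_eq0 ?oppr_eq0 ?oner_eq0 //.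
  near=> p => pq; rewrite !mul1r lt_neqAle.
  by apply/andP; split; [move: pq|]; near: p.
near=> p => pq; rewrite !mulN1r ltrN2 lt_neqAle eq_sym.
by apply/andP; split; [move: pq|]; near: p.
Unshelve. all: by end_near. Qed.

Lemma gauss_map_open q : \forall z \near G q, sphere z -> range G z.
Proof.
have [chA hcov _] := hA; have [c Ac cq] := hcov q.
have [odom orange paramK _ cparam] := chA c Ac.
set w0 := Defs.coord c q.
have cw0 : range_of c w0 by exists q.
have param_w0 : param c w0 = q by exact: paramK.
pose F := phi \o param c; pose H := eta \o param c.
have rangeP w : range_of c w ->
    dom c (param c w) /\ Defs.coord c (param c w) = w.
  by move=> [p cp <-]; rewrite paramK.
have dF w : range_of c w -> differentiable F w.
  move=> /rangeP[cp <-]; exact: differentiable_in_chart (phi_smooth himm) Ac cp.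
have dH w : range_of c w -> differentiable H w.
  move=> /rangeP[cp <-]; exact: differentiable_in_chart (eta_smooth himm) Ac cp.
have near_range w : range_of c w -> \forall w' \near w, range_of c w'.
  by move=> cw; exact: open_nbhs_nbhs.
have [sigma sigma0 strict] := support_function_strict_extremum q.
pose g z w := sigma * mink (F w) (null_vector z).
have cvg_snd_at (f : 'rV[R]_n -> 'rV[R]_(1 + n.+1)) z w : differentiable f w ->
    f p.2 @[p --> ((z, w) : 'rV[R]_n.+1 * 'rV[R]_n)] --> f w.
  by move=> /differentiable_continuous df; exact: (cvg_comp snd f cvg_snd df).
have cvg_null z w :
    null_vector p.1 @[p --> ((z, w) : 'rV[R]_n.+1 * 'rV[R]_n)] --> null_vector z.
  exact: (cvg_comp fst (@null_vector R n) cvg_fst (@continuous_null_vector R n z)).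
have gcont w z : range_of c w -> g p.1 p.2 @[p --> (z, w)] --> g z w.
  move=> cw; apply: (cvgM (cvg_cst sigma)); apply: cvg_mink.
    exact: cvg_snd_at (dF w cw).
  exact: cvg_null.
have gstrict : \forall w \near w0, w <> w0 -> g (G q) w0 < g (G q) w.
  pose S := [set p | p <> q -> sigma * mink (phi q) (null_vector (G q)) <
    sigma * mink (phi p) (null_vector (G q))].
  have h : nbhs (param c w0) S by rewrite param_w0.
  have {}h : \forall w \near w0, S (param c w) := cparam w0 cw0 S h.
  apply: filterS2 h (near_range w0 cw0) => w hw cw ww0.
  rewrite /g /F /= param_w0; apply: hw => pq.
  by apply: ww0; rewrite -(rangeP w cw).2 pq.
(* Since the null vector of [G q] is [expR (- s) *: (phi q + eta q)], the product equals
   [- 2 * expR (- s)]. *)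
have sep0 : mink (null_vector (G q)) (F w0 - H w0) != 0.
  have [s hs] := gauss_mapE hG q.
  have -> : null_vector (G q) = expR (- s) *: (phi q + eta q).
    by rewrite hs scalerA -expRD addNr expR0 scale1r.
  rewrite /F /H /= param_w0 minkZl !(minkDl, minkDr, minkNr).
  rewrite (mink_hyperbolic himm) (eta_tangent himm) (minkC (phi q)).
  rewrite (eta_tangent himm) (eta_unit himm) oppr0 addr0 add0r.
  apply: mulf_neq0; first by rewrite gt_eqF ?expR_gt0.
  by rewrite -opprD oppr_eq0 (pnatr_eq0 R 2).
have sepcont : mink (null_vector p.1) (F p.2 - H p.2) @[p --> (G q, w0)] -->
    mink (null_vector (G q)) (F w0 - H w0).
  apply: cvg_mink; first exact: cvg_null.
  apply: cvgB; apply: cvg_snd_at; [exact: dF|exact: dH].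
(* Nonvanishing persists on a product [B] times [V]; the minimum is therefore sought in [V], which
   excludes the normal direction [phi - eta]. *)
have [[B V] /= [zB wV] BV] := sepcont _ (open_neq sep0).
have hmin : \forall z \near G q, exists2 w, (V `&` range_of c) w &
    \forall w' \near w, g z w <= g z w'.
  apply: near_exists_local_min gstrict.
    by apply: filterI => //; exact: near_range.
  by apply: filterS (near_range _ cw0) => w cw z; exact: gcont.
apply: filterS2 hmin zB => z [w [Vw cw] wmin] Bz hz.
have [cp wp] := rangeP w cw.
exists (param c w) => //; apply/esym.
apply: (null_normal_gauss hA himm hG Ac cp hz).
  move=> v.
  have dg y : range_of c y -> is_derive y v (g z)
      (sigma * mink ('D_v F y) (null_vector z)).
    move=> /dF dFy.
    have := is_derive_mink v dFy (differentiable_cst (null_vector z) y).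
    rewrite derive_cst -[X in mink (F y) X](scale0r 0) minkZr mul0r addr0.
    exact: is_deriveZ.
  (* Criticality in every direction [v] says that the null vector of [z] is normal to the
     hypersurface at [param c w]. *)
  have /eqP : 'D_v (g z) w = 0.
    apply: local_min_derive0 wmin.
    by apply: filterS (near_range w cw) => y /dg[].
  rewrite (@derive_val _ _ _ _ _ _ _ (dg w cw)).
  by rewrite mulf_eq0 (negbTE sigma0) /= /dmap wp => /eqP.
exact: (BV (z, w)).
Qed.

End GaussMapOpen.

(** * Continuity of the Gauss map *)

Lemma continuous_time (R : realType) (n : nat) : continuous (@time R n).
Proof.
rewrite (_ : @time R n = fun x => x 0 (lshift n.+1 0)).
  exact: coord_continuous.
by apply/funext => x; rewrite /time mxE.
Qed.

Section ChartContinuity.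
Context {R : realType} {n : nat} {M : topologicalType}.
Context (A : set (chart R n M)) (phi eta : M -> 'rV[R]_(1 + n.+1)).
Context (hA : smooth_atlas A) (himm : immersed_hypersurface A phi eta).
Context (G : M -> 'rV[R]_n.+1).
Context (hG : gauss_map phi eta G).

Lemma smooth_map_continuous (f : M -> 'rV[R]_(1 + n.+1)) :
  smooth_map A f -> continuous f.
Proof.
move=> fsmooth p; have [chA hcov _] := hA; have [c Ac cp] := hcov p.
have [odom _ paramK ccoord _] := chA c Ac.
have cf : {for Defs.coord c p, continuous (f \o param c)}.
  exact: differentiable_continuous (differentiable_in_chart fsmooth Ac cp).
have h : f (param c (Defs.coord c q)) @[q --> p] --> f p.
  by rewrite -{2}(paramK p cp); exact: continuous_comp (ccoord p cp) cf.
apply: cvg_trans h; apply: near_eq_cvg.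
have : \forall q \near p, dom c q by exact: open_nbhs_nbhs.
by apply: filterS => q /paramK /= ->.
Qed.

(** [G] is the quotient of the space part of [phi + eta] by its time coordinate, which is an
    exponential and so never zero. *)
Lemma gauss_map_continuous : continuous G.
Proof.
move=> p.
pose f q := phi q + eta q.
have cf : f q @[q --> p] --> f p.
  by apply: cvgD; apply: smooth_map_continuous;
    [exact: phi_smooth himm|exact: eta_smooth himm].
have GE q : G q = (time (f q))^-1 *: Defs.space (f q) /\ time (f q) != 0.
  have [s fE] := gauss_mapE hG q.
  rewrite /f fE /time /Defs.space /null_vector scale_row_mx.
  rewrite row_mxKl row_mxKr !mxE mulr1.
  by rewrite scalerA mulVf ?scale1r ?gt_eqF ?expR_gt0.
rewrite (_ : G = fun q => (time (f q))^-1 *: Defs.space (f q)); last first.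
  by apply/funext => q; exact: (GE q).1.
apply: cvgZ.
  apply: cvgV; first exact: (GE p).2.
  exact: (cvg_comp f (@time R n) cf (@continuous_time R n (f p))).
exact: (cvg_comp f rsubmx cf (@continuous_rsubmx R 1 1 n.+1 (f p))).
Qed.
End ChartContinuity.

(** * Compactness in the hyperboloid and ball models *)

Section Compactness.
Context {R : realType}.

Lemma dot_ge0 k (v : 'rV[R]_k) : 0 <= dot v v.
Proof. by apply: sumr_ge0 => i _; rewrite -expr2 sqr_ge0. Qed.

Lemma sqr_coord_le_dot k (v : 'rV[R]_k) i : v 0 i ^+ 2 <= dot v v.
Proof.
rewrite /dot (bigD1 i) //= expr2 lerDl.
by apply: sumr_ge0 => j _; rewrite -expr2 sqr_ge0.
Qed.

Lemma compact_dot_le k (b : R) : compact [set v : 'rV[R]_k | dot v v <= b].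
Proof.
have cbox : compact
    [set v : 'rV[R]_k | forall i, v ord0 i \in `[- (1 + b), 1 + b]].
  apply: (@rV_compact _ _ (fun=> `[- (1 + b), 1 + b]%classic)).
  by move=> _; exact: segment_compact.
apply: subclosed_compact cbox _.
  apply: (@preimage_closed _ _ (fun v : 'rV[R]_k => dot v v) [set s | s <= b]).
    by move=> v _; apply: (@cvg_dot _ _ (nbhs v) _ _ id id); exact: cvg_id.
  exact: closed_le.
move=> v /= vb i; have := le_trans (sqr_coord_le_dot v i) vb.
rewrite in_itv /= -ler_norml => vi.
(* The bound [1 + s ^+ 2] on [s] explains the half-width [1 + b] of the box and avoids a square
   root. *)
have : `|v ord0 i| <= 1 + `|v 0 i| ^+ 2.
  by move: `|v ord0 i| => s; nra.
rewrite real_normK ?num_real // => /le_trans; apply.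
by rewrite lerD2l.
Qed.

Context {n : nat}.

Lemma dot_time_space (x : 'rV[R]_(1 + n.+1)) :
  dot x x = time x ^+ 2 + dot (Defs.space x) (Defs.space x).
Proof.
rewrite /dot big_split_ord /= big_ord1 /time /Defs.space !mxE expr2.
by congr (_ + _); apply: eq_bigr => i _; rewrite !mxE.
Qed.

Lemma dot_space_hyperbolic (x : 'rV[R]_(1 + n.+1)) : hyperbolic x ->
  dot (Defs.space x) (Defs.space x) = time x ^+ 2 - 1.
Proof.
move=> [+ _]; rewrite /mink expr2 addrC => /eqP.
by rewrite subr_eq addrC => /eqP.
Qed.

(** On the hyperboloid the Euclidean square norm is [2 * time x ^+ 2 - 1], so a bound on time bounds
    the whole vector. *)
Lemma compact_hyperbolic_time_le (b : R) :
  compact [set x : 'rV[R]_(1 + n.+1) | hyperbolic x /\ time x <= b].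
Proof.
have ctime := @continuous_time R n.
have cmink : continuous (fun x : 'rV[R]_(1 + n.+1) => mink x x).
  by move=> x; apply: (@cvg_mink _ _ _ (nbhs x) _ id id); exact: cvg_id.
apply: (subclosed_compact _ (@compact_dot_le (1 + n.+1) (2 * b ^+ 2))).
  (* The open condition [0 < time x] is replaced by a closed one: time 0 would make [mink x x]
     nonnegative. *)
  rewrite (_ : mkset _ = [set x | mink x x = - 1] `&` [set x | 0 <= time x] `&`
      [set x | time x <= b]).
    apply: closedI; first apply: closedI.
    - by apply: (preimage_closed _ (@closed_eq R (-1))) => x _; exact: cmink.
    - by apply: (preimage_closed _ (@closed_ge R 0)) => x _; exact: ctime.
    - by apply: (preimage_closed _ (@closed_le R b)) => x _; exact: ctime.
  apply/seteqP; split => x /=; first by move=> [[-> /ltW ->] ->].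
  move=> [[xx x0] xb]; split => //; split => //=.
  rewrite lt_neqAle x0 andbT; apply/eqP => t0.
  have := dot_ge0 (Defs.space x); have := xx.
  by rewrite /mink -t0 mulr0 oppr0 add0r => ->; rewrite oppr_ge0 ler10.
move=> x /= [hx xb]; rewrite dot_time_space dot_space_hyperbolic //.
have [_ /= x0] := hx.
have : time x ^+ 2 <= b ^+ 2 by rewrite ler_sqr ?nnegrE ?(le_trans _ xb) // ltW.
move=> h; rewrite mulr_natl mulr2n addrA lerBlDr.
by apply: le_trans (lerD h h) _; rewrite lerDl.
Qed.

(** The square norm is [(t - 1) / (t + 1)] with [t] the time; hence images lie in the unit ball and
    approach the sphere as time tends to infinity. *)
Lemma dot_poincare (x : 'rV[R]_(1 + n.+1)) : hyperbolic x ->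
  dot (poincare x) (poincare x) = 1 - 2 * (1 + time x)^-1.
Proof.
move=> hx; have [_ /= x0] := hx.
have t1 : 1 + time x != 0 by rewrite gt_eqF // addr_gt0.
have -> : dot (poincare x) (poincare x) =
    (1 + time x)^-1 ^+ 2 * dot (Defs.space x) (Defs.space x).
  rewrite /dot big_distrr; apply: eq_bigr => i _.
  by rewrite /poincare !mxE expr2 mulrACA.
by rewrite dot_space_hyperbolic //; field.
Qed.

Lemma cvg_of_dist_lt_inv (V : normedModType R) (u : nat -> V) (a : V) :
  (forall i, `|a - u i| < i.+1%:R^-1) -> u i @[i --> \oo] --> a.
Proof.
move=> ua; apply/cvgrPdist_lt => e e0; near=> i.
apply: lt_trans (ua i) _; near: i; exact: near_infty_natSinv_lt (PosNum e0).
Unshelve. all: by end_near. Qed.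

End Compactness.

(** * Escaping sequences and the boundary of the Gauss image *)

Theorem lemma1p1 (R : realType) (n : nat) (hn : (3 <= n)%N)
    (M : topologicalType) (A : set (chart R n M)) (hM : smooth_manifold A)
    (phi eta : M -> 'rV[R]_(1 + n.+1))
    (himm : immersed_hypersurface A phi eta)
    (hproper : properly_immersed phi)
    (hcomplete : complete_hypersurface A phi)
    (hconvex : horospherically_convex A phi eta)
    (horient : curvatures_lt1 A phi eta)
    (G : M -> 'rV[R]_n.+1) (hG : gauss_map phi eta G)
    (hregular : regular_at_infinity phi G) :
  boundary_in (sphere (k := n.+1)) (range G) `<=` ideal_boundary phi.
Proof.
have [_ _ hA] := hM.
move=> x [sx [clG clGC]].
have xNG : ~ range G x.
  move=> [q _ Gq].
  have := gauss_map_open hA himm hconvex hG q; rewrite Gq => /clGC.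
  by move=> [z [[sz zNG]]] /(_ sz).
have hyp p : hyperbolic (phi p) := phi_hyperbolic himm p.
(* By properness, the part of the hypersurface with time at most [N] has a compact, hence closed,
   Gauss image. It misses [x], so points of the Gauss image close enough to [x] come from outside
   that part. *)
have escape (N : nat) : exists p,
    `|x - G p| < N.+1%:R^-1 /\ N%:R < time (phi p).
  pose K := [set y : 'rV[R]_(1 + n.+1) | hyperbolic y /\ time y <= N%:R].
  have cK : compact (G @` (phi @^-1` K)).
    apply: continuous_compact.
      exact: continuous_subspaceT (gauss_map_continuous hA himm hG).
    by apply: hproper => [|y []//]; exact: compact_hyperbolic_time_le.
  have nK : nbhs x (~` (G @` (phi @^-1` K))).
    apply: open_nbhs_nbhs; split.
      exact/closed_openC/(compact_closed _ cK)/norm_hausdorff.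
    by move=> [p _ Gp]; apply: xNG; exists p.
  have e0 : (0 : R) < N.+1%:R^-1 by rewrite invr_gt0.
  have [_ [[p _ <-] [pK px]]] := clG _ (filterI nK (nbhsx_ballx x _ e0)).
  exists p; split; first by rewrite -ball_normE in px.
  rewrite ltNge; apply/negP => pN; apply: pK; exists p => //; split.
have [q qP] := choice escape.
have qdot N : dot (poincare (phi (q N))) (poincare (phi (q N))) =
    1 - 2 * (1 + time (phi (q N)))^-1 by rewrite dot_poincare.
have in_ball : \forall v \near poincare (phi (q i)) @[i --> \oo], dot v v <= 1.
  apply: (nearW (F := \oo)) => N; rewrite /= qdot gerBl.
  rewrite mulr_ge0 // invr_ge0 addr_ge0 //.
  exact: ltW (hyp _).2.
have [y [_ ycl]] := compact_dot_le _ in_ball.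
(* The indices need not increase; [N <= k N] suffices to keep the estimates of [escape] along the
   subsequence. *)
have /choice[k kP] (N : nat) : exists m, (N <= m)%N /\
    `|y - poincare (phi (q m))| < N.+1%:R^-1.
  have tail : \forall v \near poincare (phi (q i)) @[i --> \oo],
      exists2 m, (N <= m)%N & poincare (phi (q m)) = v.
    by exists N => // m /= Nm; exists m.
  have e0 : (0 : R) < N.+1%:R^-1 by rewrite invr_gt0.
  have [_ [[m Nm <-] ym]] := ycl _ _ tail (nbhsx_ballx y _ e0).
  by exists m; split => //; rewrite -ball_normE in ym.
pose u N := q (k N).
have uy : poincare (phi (u i)) @[i --> \oo] --> y.
  by apply: cvg_of_dist_lt_inv => i; have [] := kP i.
have le_inv N : (k N).+1%:R^-1 <= N.+1%:R^-1 :> R.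
  by rewrite lef_pV2 ?posrE // ler_nat ltnS (kP N).1.
have ux : G (u i) @[i --> \oo] --> x.
  apply: cvg_of_dist_lt_inv => i; exact: lt_le_trans (qP _).1 (le_inv i).
(* Time tends to infinity along [u], so the square norms in the ball tend to 1. *)
have sy : sphere y.
  have udot : dot (poincare (phi (u i))) (poincare (phi (u i)))
      @[i --> \oo] --> (1 : R).
    rewrite [X in _ --> X](_ : (1 : R) = 1 - 2 * 0); last by rewrite mulr0 subr0.
    under eq_fun do rewrite qdot.
    apply: cvgB; first exact: cvg_cst.
    apply: cvgM; first exact: cvg_cst.
    apply: cvg_of_dist_lt_inv => i.
    have [_ ti] := qP (k i); have t0 : 0 < 1 + time (phi (u i)).
      by rewrite addr_gt0 // (hyp _).2.
    rewrite sub0r normrN gtr0_norm ?invr_gt0 //.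
    apply: lt_le_trans (le_inv i).
    by rewrite ltf_pV2 ?posrE // -natr1 addrC ltrD2l.
  exact: (cvg_unique _ (cvg_dot uy uy) udot).
have yI : ideal_boundary phi y by split => //; exists u.
(* Regularity at infinity gives the limit [y] for [G (u i)], which also tends to [x]. *)
by rewrite (cvg_unique _ ux (hregular _ yI _ uy)).
Qed.
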